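(* Let $H$ be a hypergraph, let $k>1$ and $n\ge k$ be natural numbers, and let $r=\gcd(k,n)$. If for some $U\subseteq V(H)$ the sub-hypergraph $H_U$ of $H$ induced by $U$ is (up to isomorphism) the $k$-uniform cycle $C_n^k$ on $n$ vertices, then the dimension of the null space of $B_H$ is at least $r-1$.
   Context: A hypergraph $H$ is a pair $(V(H),E(H))$ with $V(H)$ a non-empty finite set (vertices) and $E(H)$ a set of non-empty subsets of $V(H)$ (hyperedges). The edge-vertex incidence matrix $B_H=[b_{ev}]_{e\in E(H),v\in V(H)}$ (over $\mathbb{C}$) has $b_{ev}=1$ if $v\in e$ and $b_{ev}=0$ otherwise. Its null space is a subspace of the space of functions $V(H)\to\mathbb{C}$. For (non-empty) $U\subseteq V(H)$, the sub-hypergraph $H_U$ of $H$ induced by $U$ has $V(H_U)=U$ and $E(H_U)=\{e\cap U: e\in E(H),\ e\cap U\neq\emptyset\}$. For $k\ge 2$ and $n\ge k$, the $k$-uniform cycle $C_n^k$ is the hypergraph with vertex set $\mathbb{Z}_n$ (integers modulo $n$) and hyperedge set $\{e_i: i\in\mathbb{Z}_n\}$, where $e_i=\{i,i+1,\ldots,i+(k-1)\}$ with addition in $\mathbb{Z}_n$. Two hypergraphs $H,H'$ are isomorphic if there is a bijection $f:V(H)\to V(H')$ such that $e\in E(H)$ if and only if $\{f(v):v\in e\}\in E(H')$. *)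

(* Defs.v *)
From HB Require Import structures.
From mathcomp Require Import all_boot all_order all_algebra.
From mathcomp Require Import complex reals.

Set Implicit Arguments.
Unset Strict Implicit.
Unset Printing Implicit Defensive.

Import GRing.Theory.

Local Open Scope ring_scope.
Local Open Scope complex_scope.

Record hypergraph := Hypergraph {
  vert :> finType;
  hedges : {set {set vert}};
  vert_gt0 : (0 < #|vert|)%N;
  set0_hedges : set0 \notin hedges
}.

Definition hypergraph_iso (H H' : hypergraph) : Prop :=
  exists f : H -> H', bijective f /\
    forall e : {set H}, e \in hedges H <-> f @: e \in hedges H'.

Section Induced.
Variables (H : hypergraph) (U : {set H}).

(* The trace of e on U, as a set of elements of the subtype of U. *)
Definition trace (e : {set H}) : {set {v : H | v \in U}} :=
  [set v | val v \in e].

Definition induced_hedges : {set {set {v : H | v \in U}}} :=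
  [set trace e | e in hedges H & e :&: U != set0].

Lemma induced_vert_gt0 : U != set0 -> (0 < #|{: {v : H | v \in U}}|)%N.
Proof. by rewrite card_sig card_gt0. Qed.

Lemma set0_induced_hedges : set0 \notin induced_hedges.
Proof.
apply/imsetP => -[e]; rewrite inE => /andP[_ /set0Pn[v]].
rewrite inE => /andP[ve vU] /setP/(_ (exist _ v vU)).
by rewrite !inE /= ve.
Qed.

Definition induced (U0 : U != set0) : hypergraph :=
  Hypergraph (induced_vert_gt0 U0) set0_induced_hedges.

End Induced.

Section UniformCycle.
Variables n k : nat.

(* 'Z_n is the ring of integers modulo n only for 1 < n, which holds in
   [uniform_cycle] below since 1 < k <= n. *)
Definition cycle_hedge (i : 'Z_n) : {set 'Z_n} := [set i + j%:R | j : 'I_k].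

Definition cycle_hedges : {set {set 'Z_n}} := [set cycle_hedge i | i : 'Z_n].

Lemma cycle_vert_gt0 : (0 < #|'Z_n|)%N.
Proof. by rewrite card_ord. Qed.

Lemma set0_cycle_hedges : (1 < k)%N -> set0 \notin cycle_hedges.
Proof.
move=> k_gt1; apply/imsetP => -[i _] /setP/(_ i).
rewrite inE => /esym/negP; apply; apply/imsetP.
by exists (Ordinal (ltnW k_gt1)); rewrite ?addr0.
Qed.

Definition uniform_cycle (k_gt1 : (1 < k)%N) (le_kn : (k <= n)%N) : hypergraph :=
  Hypergraph cycle_vert_gt0 (set0_cycle_hedges k_gt1).

End UniformCycle.

Definition incidence (R : realType) (H : hypergraph) :
    'M[R[i]]_(#|hedges H|, #|H|) :=
  \matrix_(e < #|hedges H|, v < #|H|) (enum_val v \in enum_val e)%:R.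

Definition null_space (F : fieldType) (m n : nat) (A : 'M[F]_(m, n)) :
    {vspace 'cV[F]_n} :=
  lker (linfun (mulmx A : 'cV[F]_n -> 'cV[F]_m)).

Lemma mem_null_space (F : fieldType) (m n : nat) (A : 'M[F]_(m, n))
    (x : 'cV[F]_n) : (x \in null_space A) = (A *m x == 0).
Proof. by rewrite memv_ker lfunE. Qed.

(* Main.v *)
Require Import Defs.
From mathcomp Require Import all_boot all_order all_algebra.
From mathcomp Require Import complex reals.

(** Write r = gcd(k, n) and let f identify U with the integers modulo n.
    Residues modulo r are well defined on Z_n because r divides n, and each
    hyperedge of the cycle, being made of k consecutive integers with r
    dividing k, contains exactly k / r elements of each residue class
    ([sum_cycle_hedge]).  So if F : Z_r -> C has sum zero, the function F o f
    sums to zero on each hyperedge of H_U.  Extended by zero outside U, it sums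
    to zero on each hyperedge e of H: only e :&: U contributes, and it is either
    empty or a hyperedge of H_U ([sum_zero_ext_hedge]).  The functions F of sum
    zero form a space of dimension r - 1, and F is recovered from its extension, which
    thus embeds this space into the null space of the incidence matrix.  The
    basis delta_(c+1) - delta_0 (c < r - 1) makes the embedding a matrix with an
    explicit left inverse, as [leq_dim_null_space] asks. *)

Set Implicit Arguments.
Unset Strict Implicit.
Unset Printing Implicit Defensive.

Import GRing.Theory.

Local Open Scope ring_scope.

(** Q makes multiplication by P injective, and the image of P lies in the null
    space. *)
Lemma leq_dim_null_space (F : fieldType) (m n p : nat) (A : 'M[F]_(m, n))
    (P : 'M[F]_(n, p)) (Q : 'M[F]_(p, n)) :
  A *m P = 0 -> Q *m P = 1%:M -> (p <= \dim (null_space A))%N.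
Proof.
move=> AP0 QP1; pose h := linfun (mulmx P : 'cV[F]_p -> 'cV[F]_n).
have sub_h : (limg h <= null_space A)%VS.
  apply/subvP => _ /memv_imgP[x _ ->].
  by rewrite mem_null_space lfunE /= mulmxA AP0 mul0mx.
have ker_h : (fullv :&: lker h = 0)%VS.
  apply/eqP; rewrite capfv -subv0; apply/subvP => x.
  rewrite memv_ker lfunE /= memv0 => /eqP Px0.
  by rewrite -[x]mul1mx -QP1 -mulmxA Px0 mulmx0.
have := dimvS sub_h; rewrite (limg_dim_eq ker_h) dimvf.
by rewrite /dim /= muln1.
Qed.

(** One full period of length r meets each residue class once, wherever it
    starts: moving the start by one replaces i by i + r, which is congruent to
    it. *)
Lemma sum_period (V : nmodType) (F : nat -> V) (r i : nat) :
  \sum_(j < r) F ((i + j) %% r)%N = \sum_(c < r) F c.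
Proof.
elim: i => [|i <-]; first by apply: eq_bigr => j _; rewrite add0n modn_small.
case: r => [|r]; first by rewrite !big_ord0.
rewrite big_ord_recr [RHS]big_ord_recl /= addrC addn0.
congr (_ + _); first by rewrite addSnnS modnDr.
by apply: eq_bigr => j _; rewrite addSnnS.
Qed.

Lemma sum_consecutive_mod (V : nmodType) (F : nat -> V) (r q i : nat) :
  \sum_(j < q * r) F ((i + j) %% r)%N = (\sum_(c < r) F c) *+ q.
Proof.
elim: q i => [|q IHq] i; first by rewrite mul0n big_ord0.
rewrite mulSn big_split_ord /= sum_period mulrS; congr (_ + _).
rewrite -(IHq i); apply: eq_bigr => j _.
by rewrite addnCA modnDl.
Qed.

Lemma sum_cycle_hedge (V : nmodType) (F : nat -> V) (n k r : nat) (i : 'Z_n) :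
  (1 < n)%N -> (k <= n)%N -> (r %| k)%N -> (r %| n)%N ->
  \sum_(z in cycle_hedge k i) F (z %% r)%N = (\sum_(c < r) F c) *+ (k %/ r).
Proof.
move=> n_gt1 le_kn /divnK def_k r_n.
(* The first equation is where k <= n matters: j < k is its own residue. *)
have natE (j : 'I_k) : (j%:R : 'Z_n) = j :> nat.
  by rewrite val_Zp_nat // modn_small // (leq_trans _ le_kn).
have addE (j : 'I_k) : (i + j%:R : 'Z_n) = ((i + j) %% n)%N :> nat.
  by rewrite /= natE [X in (_ %% X)%N]Zp_cast.
rewrite big_imset /=; last first.
  move=> j1 j2 _ _ /addrI/(congr1 (@nat_of_ord _)).
  by rewrite !natE => /ord_inj.
transitivity (\sum_(j < k) F ((i + j) %% r)%N).
  by apply: eq_bigr => j _; rewrite -(modn_dvdm (i + j) r_n) -addE.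
by rewrite -(sum_consecutive_mod F r _ i) def_k.
Qed.

Definition zero_ext (V : nmodType) (T : finType) (U : {set T})
    (g : {v : T | v \in U} -> V) (v : T) : V := oapp g 0 (insub v).

Lemma zero_ext_val (V : nmodType) (T : finType) (U : {set T})
    (g : {v : T | v \in U} -> V) w : zero_ext g (val w) = g w.
Proof. by rewrite /zero_ext valK. Qed.

Lemma sum_zero_ext (V : nmodType) (H : hypergraph) (U : {set H})
    (g : {v : H | v \in U} -> V) (e : {set H}) :
  \sum_(v in e) zero_ext g v = \sum_(w in trace U e) g w.
Proof.
rewrite (bigID (mem U)) /= [X in _ + X]big1 ?addr0; last first.
  by move=> v /andP[_ /negP vU]; rewrite /zero_ext insubN //; apply/negP.
rewrite (reindex_omap (val : {v : H | v \in U} -> H) insub) /=; last first.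
  by move=> v /andP[_ vU]; rewrite insubT.
apply: eq_big => [w|w _]; last exact: zero_ext_val.
by rewrite valK eqxx andbT inE (valP w) andbT.
Qed.

(** The trace of e on U is a hyperedge of the induced hypergraph unless it is
    empty, and an empty sum is zero. *)
Lemma sum_zero_ext_hedge (V : nmodType) (H : hypergraph) (U : {set H})
    (U0 : U != set0) (g : induced U0 -> V) (e : {set H}) :
  (forall e', e' \in hedges (induced U0) -> \sum_(w in e') g w = 0) ->
  e \in hedges H -> \sum_(v in e) zero_ext g v = 0.
Proof.
move=> g0 eH; rewrite sum_zero_ext.
have [eU0|eU] := eqVneq (e :&: U) set0.
  apply: big1 => w; rewrite inE => we.
  by have := in_set0 (val w); rewrite -eU0 inE we (valP w).
by apply: g0; apply/imsetP; exists e; rewrite // inE eH.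
Qed.

Theorem corollary2p12 (R : realType) (H : hypergraph) (k n : nat)
    (k_gt1 : (1 < k)%N) (le_kn : (k <= n)%N) (U : {set H}) (U0 : U != set0) :
  hypergraph_iso (induced U0) (uniform_cycle k_gt1 le_kn) ->
  (gcdn k n - 1 <= \dim (null_space (incidence R H)))%N.
Proof.
move=> [f [[f' fK f'K] f_hedges]]; set r := gcdn k n.
have n_gt1 : (1 < n)%N := leq_trans k_gt1 le_kn.
have r_n : (r %| n)%N := dvdn_gcdr k n.
have r_k : (r %| k)%N := dvdn_gcdl k n.
have r_gt0 : (0 < r)%N by rewrite gcdn_gt0 (ltnW k_gt1).
have ltS_r (c : 'I_(r - 1)) : (c.+1 < r)%N by have := ltn_ord c; rewrite ltn_subRL.
pose F (c : 'I_(r - 1)) (s : nat) : complex R :=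
  (s == c.+1)%:R - (s == 0)%:R.
have sumF c : \sum_(s < r) F c s = 0.
  have sum_delta s0 : (s0 < r)%N ->
      \sum_(s < r) (s == s0 :> nat)%:R = 1 :> complex R.
    move=> lt_s0; rewrite (bigD1 (Ordinal lt_s0)) //= eqxx big1 ?addr0 // => s.
    by rewrite -val_eqE /= => /negPf->.
  by rewrite sumrB !sum_delta ?subrr.
pose g c (w : induced U0) : complex R := F c ((f w : 'Z_n) %% r)%N.
have g0 c e : e \in hedges (induced U0) -> \sum_(w in e) g c w = 0.
  move=> /f_hedges/imsetP[i _ def_fe].
  have := sum_cycle_hedge (F c) i n_gt1 le_kn r_k r_n.
  rewrite sumF mul0rn -def_fe big_imset //=.
  by move=> w1 w2 _ _; apply: (can_inj fK).
pose P := \matrix_(v < #|H|, c < r - 1) zero_ext (g c) (enum_val v).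
(* Evaluation at the vertex numbered c + 1 by f inverts P on the left, as
   c + 1 < r is its own residue. *)
pose Q : 'M[complex R]_(r - 1, #|H|) :=
  \matrix_(c < r - 1, v < #|H|)
    (v == enum_rank (val (f' (inZp c.+1 : 'Z_n))))%:R.
apply: (@leq_dim_null_space _ _ _ _ _ P Q).
  apply/matrixP => e c; rewrite !mxE.
  have := sum_zero_ext_hedge (g0 c) (enum_valP e).
  rewrite (reindex (@enum_val _ H)) /=; last exact/onW_bij/enum_val_bij.
  rewrite big_mkcond /= => def0; rewrite -[RHS]def0; apply: eq_bigr => v _.
  by rewrite !mxE; case: ifP; rewrite ?mul1r ?mul0r.
apply/matrixP => c d; rewrite !mxE.
rewrite (bigD1 (enum_rank (val (f' (inZp c.+1 : 'Z_n))))) //=.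
rewrite big1 => [|v /negPf v_neq]; last by rewrite !mxE v_neq mul0r.
rewrite !mxE eqxx mul1r addr0 enum_rankK zero_ext_val /g f'K /=.
rewrite Zp_cast // (modn_dvdm _ r_n) modn_small // /F eqSS subr0.
by rewrite val_eqE.
Qed.
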